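(* (Lagrange's identity) Let $\mathbb{F}$ be a field of characteristic not $2$ and let $B$ be an invertible symmetric $3\times 3$ matrix over $\mathbb{F}$. For all vectors $v_1,v_2\in\mathbb{V}^3=\mathbb{F}^3$, $$Q_B(v_1\times_B v_2)=(\det B)\left[Q_B(v_1)Q_B(v_2)-(v_1\cdot_B v_2)^2\right].$$
   Context: $\mathbb{V}^3$ is the space of row vectors $(x,y,z)$ over $\mathbb{F}$. The $B$-scalar product is $v\cdot_B w=vBw^T$, and the $B$-quadrance is $Q_B(v)=v\cdot_B v$. The Euclidean vector product is $(x_1,y_1,z_1)\times(x_2,y_2,z_2)=(y_1z_2-y_2z_1,\;x_2z_1-x_1z_2,\;x_1y_2-x_2y_1)$. The $B$-vector product is $v\times_B w=(v\times w)\,\mathrm{adj}\,B$ (row vector times matrix), where $\mathrm{adj}\,B=(\det B)B^{-1}$ is the adjugate of $B$. *)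

(* Defs.v *)
From mathcomp Require Import all_boot all_algebra.

Set Implicit Arguments.
Unset Strict Implicit.
Unset Printing Implicit Defensive.

Import GRing.Theory.
Local Open Scope ring_scope.

(* The 1 x 1 matrix v B w^T is identified with its unique entry. *)
Definition Bdot (F : fieldType) (B : 'M[F]_3) (v w : 'rV[F]_3) : F :=
  (v *m B *m w^T) 0 0.

Definition Bquad (F : fieldType) (B : 'M[F]_3) (v : 'rV[F]_3) : F :=
  Bdot B v v.

(* The coordinates x, y, z of v are v 0 0, v 0 1, v 0 2. *)
Definition cross (F : fieldType) (v w : 'rV[F]_3) : 'rV[F]_3 :=
  \row_(j < 3) nth 0 [:: v 0 1 * w 0 2 - w 0 1 * v 0 2;
                         w 0 0 * v 0 2 - v 0 0 * w 0 2;
                         v 0 0 * w 0 1 - w 0 0 * v 0 1] j.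

Definition Bcross (F : fieldType) (B : 'M[F]_3) (v w : 'rV[F]_3) : 'rV[F]_3 :=
  cross v w *m \adj B.

(* The library adjugate (transposed cofactor matrix) is (\det B) B^-1 when B is
   invertible. *)
Lemma adj_det_inv (F : fieldType) (B : 'M[F]_3) :
  B \in unitmx -> \adj B = \det B *: invmx B.
Proof.
move=> uB; have := mul_adj_mx B; move/(congr1 (mulmx^~ (invmx B))).
by rewrite mulmxK // mul_scalar_mx.
Qed.

(* Main.v *)
Require Import Defs.
From mathcomp Require Import all_boot all_algebra.
From mathcomp Require Import ring.
Import GRing.Theory.
Local Open Scope ring_scope.

(** The adjugate of a 3 x 3 matrix is the transposed matrix of its signed 2 x 2
    minors, so it governs how the Euclidean vector product reacts to a linear
    change of coordinates: [(v M) x (w M) = (v x w) (adj M)^T]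
    ([cross_mulmx]).  For symmetric [B] the B-vector product is therefore just
    [(v B) x (w B)].

    Write [u = v1 x v2].  The quadrance of [u adj B] is
    [u (adj B) B (adj B)^T u^T], and [(adj B) B = det B] extracts the factor
    [det B], leaving [det B * (u adj B) u^T].  Since [u adj B] is
    [(v1 B) x (v2 B)], what is left is the Euclidean scalar product of
    [(v1 B) x (v2 B)] and [v1 x v2].  The Binet-Cauchy identity
    ([cross_dot_cross]) evaluates it as the 2 x 2 determinant of the scalar
    products of [v1 B], [v2 B] with [v1], [v2], which are B-scalar products. *)

Lemma mulmx3E (R : pzSemiRingType) m n (A : 'M[R]_(m, 3)) (B : 'M[R]_(3, n))
    i j :
  (A *m B) i j = A i 0 * B 0 j + A i 1 * B 1 j + A i 2 * B 2 j.
Proof.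
rewrite mxE !big_ord_recl big_ord0 addr0 addrA.
by do !congr (_ + _); congr (A i _ * B _ j); apply: val_inj.
Qed.

Lemma det2E (R : comPzRingType) (A : 'M[R]_2) :
  \det A = A 0 0 * A 1 1 - A 0 1 * A 1 0.
Proof.
rewrite (expand_det_row _ 0) !big_ord_recl big_ord0 addr0 /cofactor !det_mx11.
rewrite !mxE expr0 expr1 mul1r mulN1r mulrN.
by congr (A _ _ * A _ _ - A _ _ * A _ _); apply: val_inj.
Qed.

(** The coordinates of [v x w] are the signed 2 x 2 minors of the pair [v, w];
    by multiplicativity of minors (Cauchy-Binet) they transform under [M] by
    the matrix of cofactors, which is the transposed adjugate. *)
Lemma cross_mulmx (F : fieldType) (M : 'M[F]_3) (v w : 'rV[F]_3) :
  cross (v *m M) (w *m M) = cross v w *m (\adj M)^T.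
Proof.
apply/rowP => j; rewrite mulmx3E ![(\adj M)^T _ _]mxE ![\adj M _ _]mxE.
rewrite /cofactor !det2E ![cross _ _ _ _]mxE !mulmx3E !mxE.
(* Deleting rows and columns produces indices of the form [lift i k]; reading
   the entries of [M] through natural numbers lets these indices compute. *)
pose m i k := M (inord i) (inord k).
have ME i k : M i k = m i k by rewrite /m !inord_val.
by rewrite !ME; case: j => [[|[|[|//]]] lt_j] /=; ring.
Qed.

(** Binet-Cauchy: the mixed Gram determinant of the pairs [a, b] and [c, d] is the
    sum of the products of their corresponding 2 x 2 minors. *)
Lemma cross_dot_cross (F : fieldType) (a b c d : 'rV[F]_3) :
  (cross a b *m (cross c d)^T) 0 0
    = (a *m c^T) 0 0 * (b *m d^T) 0 0 - (a *m d^T) 0 0 * (b *m c^T) 0 0.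
Proof. by rewrite !mulmx3E /cross !mxE /=; ring. Qed.

Lemma BdotC (F : fieldType) (B : 'M[F]_3) (v w : 'rV[F]_3) :
  B^T = B -> Bdot B v w = Bdot B w v.
Proof.
move=> B_sym; rewrite /Bdot -[in LHS](trmxK (v *m B *m w^T)) mxE.
by rewrite !trmx_mul trmxK B_sym mulmxA.
Qed.

Lemma Bcross_sym (F : fieldType) (B : 'M[F]_3) (v w : 'rV[F]_3) :
  B^T = B -> Bcross B v w = cross (v *m B) (w *m B).
Proof. by move=> B_sym; rewrite cross_mulmx trmx_adj B_sym. Qed.

Theorem theorem8 (F : fieldType) (hF : 2%N \notin [pchar F])
    (B : 'M[F]_3) (B_inv : B \in unitmx) (B_sym : B^T = B)
    (v1 v2 : 'rV[F]_3) :
  Bquad B (Bcross B v1 v2)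
    = \det B * (Bquad B v1 * Bquad B v2 - Bdot B v1 v2 ^+ 2).
Proof.
have -> : Bquad B (Bcross B v1 v2)
    = \det B * (cross (v1 *m B) (v2 *m B) *m (cross v1 v2)^T) 0 0.
  rewrite -(Bcross_sym _ _ _ _ B_sym) /Bquad /Bdot /Bcross.
  rewrite -[_ *m \adj B *m B]mulmxA mul_adj_mx mul_mx_scalar -scalemxAl mxE.
  by rewrite trmx_mul trmx_adj B_sym mulmxA.
rewrite cross_dot_cross -!/(Bdot B _ _) (BdotC _ _ v2 v1 B_sym).
by rewrite expr2.
Qed.
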